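(* Let $n\ge 1$ and let $k$ be an integer with $0\le k\le n/2$. Then $$\sigma_o(k):=(1,n-k+1)(2,n-k+2)\cdots(k,n)$$ is the unique minimal involution in $\mathbf{S}_n^2(k)$ (with respect to $\preceq$), and for any $\sigma\in\mathbf{S}_n^2(k)$ one has $\sigma_o(k)\preceq\sigma$. In particular, for any $S,T\in\mathbf{Tab}_n^2(k)$ one has $\mathcal{V}_T\cap\mathcal{V}_S\neq\emptyset$.
   Context: Everything is over $\mathbb{C}$. $\mathfrak{n}=\mathfrak{n}_n$ is the space of strictly upper-triangular $n\times n$ matrices. For $1\le i\le j\le n$, $\pi_{i,j}:\mathfrak{n}_n\to\mathfrak{n}_{j-i+1}$ is the map deleting the first $i-1$ rows and columns and the last $n-j$ rows and columns of a matrix. Bars denote Zariski closure. $\mathbf{S}_n^2:=\{\sigma\in\mathbf{S}_n : \sigma^2=\mathrm{id}\}$ (the identity is included). For $\sigma\in\mathbf{S}_n^2$, $L(\sigma)$ is the number of 2-cycles in its disjoint cycle decomposition, and $\mathbf{S}_n^2(k):=\{\sigma\in\mathbf{S}_n^2 : L(\sigma)=k\}$. $N_\sigma$ is the $n\times n$ matrix with $(N_\sigma)_{i,j}=1$ if $i<j$ and $\sigma(i)=j$, and $0$ otherwise. $R_\sigma$ is the $n\times n$ matrix with $(R_\sigma)_{i,j}=0$ if $i\ge j$ and $(R_\sigma)_{i,j}=\mathrm{rk}(\pi_{i,j}(N_\sigma))$ if $i<j$. For $\sigma,\sigma'\in\mathbf{S}_n^2$, $\sigma'\preceq\sigma$ means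 $(R_{\sigma'})_{i,j}\le(R_\sigma)_{i,j}$ for all $i,j$. For a nilpotent matrix $x$, $J(x)$ is the partition given by the sizes of its Jordan blocks in decreasing order; partitions are identified with Young diagrams with row lengths $\lambda_1\ge\lambda_2\ge\cdots$. For a partition $\lambda$ of $n$, $\mathcal{O}_\lambda$ is the $\mathrm{GL}_n$-conjugacy class of nilpotent matrices $x$ with $J(x)=\lambda$. $\mathbf{Tab}_n^2(k)$ is the set of standard Young tableaux (entries $1,\dots,n$, increasing along rows and down columns) with shape $\lambda=(n-k,k)^*$, the conjugate partition of $(n-k,k)$; i.e. the tableaux have first column of length $n-k$ and second column of length $k$. For a standard Young tableau $T$ of shape $\lambda$, the orbital variety $\mathcal{V}_T$ (an irreducible component of $\mathcal{O}_\lambda\cap\mathfrak{n}$) is $$\mathcal{V}_T:=\overline{\{u\in\mathcal{O}_\lambda\cap\mathfrak{n} : J(\pi_{1,i}(u))=\mathrm{sh}(T_{\le i})\ \text{for all } 1\le i\le n\}}\cap\mathcal{O}_\lambda,$$ where $\mathrm{sh}(T_{\le i})$ is the shape of the subtableau of $T$ formed by the entries $1,\dots,i$. *)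

(* Defs.v *)
From mathcomp Require Import all_boot all_order all_algebra all_fingroup.
From mathcomp Require Import classical_sets.
From mathcomp Require mpoly.

Set Implicit Arguments.
Unset Strict Implicit.
Unset Printing Implicit Defensive.

Import GRing.Theory.

Local Open Scope ring_scope.

(* In permutations and matrix indices, 1, ..., n are the elements
   0, ..., n - 1 of 'I_n. *)

Definition L n (s : 'S_n) : nat := #|[set c in porbits s | #|c| == 2]|%N.

Definition invol n (s : 'S_n) : Prop := (s * s = 1)%g.

Definition invol_of n (k : nat) (s : 'S_n) : Prop := invol s /\ L s = k.

(* The product of the transpositions (a + 1, n - k + a + 1) for a < k.  For
   k <= n and a < k one has n - k + a < n, so the default of insubd is unused. *)
Definition sigma_o (n k : nat) : 'S_n :=
  (\prod_(a < n | (a < k)%N) tperm a (insubd a (n - k + a)%N))%g.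

Section Matrices.
Variable F : fieldType.

(* pi_{i,j} with the indices i and j counted from 1; for 1 <= i <= j <= n all
   the positions involved are in range and the value 0 is never used. *)
Definition pi_mx n (i j : nat) (A : 'M[F]_n) : 'M[F]_((j - i).+1) :=
  \matrix_(a, b)
    match (insub (i.-1 + a)%N : option 'I_n),
          (insub (i.-1 + b)%N : option 'I_n) with
    | Some p, Some q => A p q
    | _, _ => 0
    end.

Definition N_mx n (s : 'S_n) : 'M[F]_n :=
  \matrix_(i, j) ((i < j)%N && (s i == j))%:R.

Definition R_mx n (s : 'S_n) : 'M[nat]_n :=
  \matrix_(i, j) if (i < j)%N then \rank (pi_mx i.+1 j.+1 (N_mx s)) else 0%N.

Definition invol_le n (s' s : 'S_n) : Prop :=
  forall i j : 'I_n, (R_mx s' i j <= R_mx s i j)%N.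

Definition minimal_invol n (k : nat) (s : 'S_n) : Prop :=
  invol_of k s /\
  (forall s' : 'S_n, invol_of k s' -> invol_le s' s -> s' = s).

Definition is_partition (n : nat) (la : seq nat) : Prop :=
  [/\ sorted geq la, 0%N \notin la & sumn la = n].

(* For la of sum n, the block diagonal matrix of the nilpotent Jordan blocks
   of sizes la_1, la_2, ...; reshape_index la i is the index of the block
   containing the row i. *)
Definition jordan_mx n (la : seq nat) : 'M[F]_n :=
  \matrix_(i, j)
    ((j == i.+1 :> nat) && (reshape_index la i == reshape_index la j))%:R.

(* x is nilpotent and J(x) = la; nilpotency follows from the conjugacy. *)
Definition jordan_type n (x : 'M[F]_n) (la : seq nat) : Prop :=
  is_partition n la /\
  (exists2 P : 'M[F]_n, P \in unitmx & P *m x *m invmx P = jordan_mx n la).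

Local Open Scope classical_set_scope.

Definition strict_upper n : set 'M[F]_n :=
  [set x | forall i j : 'I_n, (j <= i)%N -> x i j = 0].

Definition nilp_orbit n (la : seq nat) : set 'M[F]_n :=
  [set x | jordan_type x la].

(* Closures are taken in the space of all n x n matrices, in which the
   strictly upper triangular ones are closed. *)

Definition zero_locus n (I : set (mpoly.mpoly (n * n) F)) : set 'M[F]_n :=
  [set x | forall p, I p -> mpoly.meval (mxvec x 0) p = 0].

Definition zariski_closed n (A : set 'M[F]_n) : Prop :=
  exists I, A = zero_locus I.

Definition zariski_closure n (A : set 'M[F]_n) : set 'M[F]_n :=
  smallest (@zariski_closed n) A.

End Matrices.

(* A tableau is the sequence of its rows. *)

Definition std_tableau (n : nat) (T : seq (seq nat)) : Prop :=
  [/\ is_partition n (shape T),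
      perm_eq (flatten T) (iota 1 n),
      all (sorted ltn) T &
      forall i j : nat, (j < size (nth [::] T i.+1))%N ->
        (nth 0%N (nth [::] T i) j < nth 0%N (nth [::] T i.+1) j)%N].

(* The shape of the subtableau with entries at most i; rows that become empty
   are dropped. *)
Definition sub_shape (T : seq (seq nat)) (i : nat) : seq nat :=
  [seq r <- shape [seq [seq x <- row | (x <= i)%N] | row <- T] | (0 < r)%N].

Definition conj_part (la : seq nat) : seq nat :=
  [seq count (fun r => (j < r)%N) la | j <- iota 0 (head 0%N la)].

Definition Tab2 (n k : nat) (T : seq (seq nat)) : Prop :=
  std_tableau n T /\ shape T = conj_part [:: (n - k)%N; k].

Definition orbital_variety (F : fieldType) n (T : seq (seq nat)) :
    set 'M[F]_n :=
  let la := shape T in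
  (zariski_closure
     [set u | nilp_orbit la u /\ strict_upper u /\
        forall i : nat, (1 <= i <= n)%N ->
          jordan_type (pi_mx 1 i u) (sub_shape T i)]
   `&` nilp_orbit la)%classic.

Arguments orbital_variety : clear implicits.

(* Main.v *)
Require Import Defs.
From mathcomp Require Import all_boot all_order all_algebra all_fingroup.
From mathcomp Require Import classical_sets reals complex.
From mathcomp Require Import (canonicals) mpoly.
From mathcomp Require Import zify ring.

Set Implicit Arguments.
Unset Strict Implicit.
Unset Printing Implicit Defensive.

Import GRing.Theory.
Local Open Scope ring_scope.

(** An involution s has one arc (p, s p) for every 2-cycle, p being the smaller
    endpoint, and R_s(i, j) counts the arcs contained in the interval [i, j].
    Cutting [1, n] down to [i, j] removes n - (j - i + 1) points, and each of them
    destroys at most one arc; hence R_s(i, j) >= k - (n - (j - i + 1)) as soon as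
    s has k arcs.  The k arcs of sigma_o(k) all have the length n - k, and for them
    this bound (truncated at 0) is an equality, so that sigma_o(k) lies below
    every other involution ([sigma_o_le]).  Conversely, below sigma_o(k) no arc can
    be shorter than n - k, and only sigma_o(k) has k arcs that long
    ([sigma_o_of_long_arcs]); this gives minimality, and uniqueness follows.

    For the orbital varieties, the partial permutation matrix N_o of sigma_o(k)
    is a common point of all of them.  Given a two-column tableau T, the rows
    [x; y] of T are the arcs of an involution whose matrix lies in the stratum
    that defines V_T: listing the entries row by row puts the matrix and all its
    corner blocks in Jordan form ([row_pair_mx_stratum]).  The stratum, hence its
    closure, is stable under conjugation by invertible upper triangular matrices.
    If the row i and the column i + 1 of M vanish, then conjugation by the curve of
    triangular matrices with the block [-1/t, 1; 0, t] in the positions i, i + 1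
    has a limit at t = 0, which is M with i and i + 1 exchanged ([degenerate_swap]).
    In terms of arcs, such a move exchanges two neighbours and brings openings to
    the left or closings to the right; as long as some move changes anything one
    can go on, and the process ends exactly when all openings come first and all
    closings last, that is at N_o ([arc_mx_reach]). *)

(** * Involutions and ranks *)

(** The rows in P are distinct unit vectors, so that they form a matrix B with
    B B^T = 1, and the other rows vanish. *)
Lemma rank_partial_perm (F : fieldType) m n (P : pred 'I_m) (f : 'I_m -> 'I_n) :
  {in P &, injective f} ->
  \rank (\matrix_(a, b) (P a && (f a == b))%:R : 'M[F]_(m, n)) = #|P|.
Proof.
move=> injf; set A := (X in \rank X).
pose B : 'M[F]_(#|P|, n) := rowsub (fun a : 'I_#|P| => enum_val a) A.
have rB : row_free B.
  apply/row_freeP; exists B^T; apply/matrixP => a b; rewrite !mxE.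
  rewrite (bigD1 (f (enum_val a))) //= big1 => [|c cNa]; last first.
    by rewrite !mxE [_ == c]eq_sym (negPf cNa) andbF mul0r.
  rewrite !mxE eqxx [P _](enum_valP a) [P _](enum_valP b) !andTb.
  rewrite mul1r addr0 (inj_in_eq injf) ?enum_valP //.
  by rewrite (inj_eq enum_val_inj) eq_sym.
rewrite -[RHS](eqP rB); apply: eqmx_rank; apply/andP; split;
  apply/row_subP => a.
  have [Pa|PNa] := boolP (P a); last first.
    suff -> : row a A = 0 by apply: sub0mx.
    by apply/rowP => b; rewrite !mxE (negPf PNa).
  have -> : row a A = row (enum_rank_in Pa a) B.
    by apply/rowP => b; rewrite !mxE enum_rankK_in.
  exact: row_sub.
by rewrite row_rowsub row_sub.
Qed.

Lemma involK n (s : 'S_n) : invol s -> involutive s.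
Proof. by move=> s2 p; rewrite -permM s2 perm1. Qed.

Lemma porbit_invol n (s : 'S_n) p : invol s -> porbit s p = [set p; s p].
Proof.
move=> sK; apply/setP => q; rewrite !inE; apply/porbitP/orP.
  case=> i ->; rewrite -(odd_double_half i) addnC expgD -mul2n expgM.
  have -> : (s ^+ 2 = 1)%g by rewrite expgS expg1.
  by rewrite expg1n mul1g; case: odd; rewrite ?expg1 ?expg0 ?perm1; auto.
by case=> /eqP->; [exists 0%N; rewrite expg0 perm1 | exists 1%N; rewrite expg1].
Qed.

Lemma L_arcs n (s : 'S_n) : invol s -> L s = #|[set p : 'I_n | (p < s p)%N]|.
Proof.
move=> sI; have sK := involK sI.
have injo : {in [set p : 'I_n | (p < s p)%N] &, injective (porbit s)}.
  move=> p q; rewrite !inE => ps qs pq.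
  have : q \in porbit s p by rewrite pq porbit_id.
  rewrite porbit_invol // !inE => /orP[/eqP //|/eqP qp].
  by move: ps qs; rewrite qp sK; lia.
rewrite -(card_in_imset injo); apply: eq_card => c; rewrite inE.
apply/andP/imsetP.
  case=> /imsetP[p _ ->]; rewrite porbit_invol // cards2.
  have [->|psp _] := eqVneq p (s p); rewrite ?sK ?eqxx //.
  have [lt|ge] := ltnP p (s p); first by exists p; rewrite ?inE ?porbit_invol.
  exists (s p); rewrite ?inE ?porbit_invol ?sK 1?finset.setUC //.
  by rewrite ltn_neqAle ge andbT; apply: contraNneq psp => /val_inj ->.
case=> p; rewrite inE => lt ->; rewrite imset_f // porbit_invol // cards2.
by split=> //; apply/eqP; congr (_.+1); apply/eqP; rewrite eqb1;
  apply: contraTneq lt => <-; rewrite ltnn.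
Qed.

(** The block of N_s is again a partial permutation matrix, and its nonzero rows
    are the left endpoints of the arcs inside [i, j]. *)
Lemma R_arcs (F : fieldType) n (s : 'S_n) (i j : 'I_n) : (i < j)%N ->
  R_mx F s i j = #|[set p : 'I_n | [&& i <= p, p < s p & s p <= j]%N]|.
Proof.
move=> ij; rewrite mxE ij.
have lt (a : 'I_(j.+1 - i.+1).+1) : (i + a < n)%N.
  by have := ltn_ord a; have := ltn_ord j; lia.
pose w a := Ordinal (lt a).
have winj : injective w by move=> a b /(congr1 val) /= /addnI /val_inj.
pose P a := (w a < s (w a) <= j)%N.
pose f a : 'I_(j.+1 - i.+1).+1 := inord (s (w a) - i).
have fP a : P a -> (i + f a = s (w a))%N.
  by rewrite /P /= => /andP[]; rewrite /f => ? ?; rewrite inordK; lia.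
have -> : pi_mx i.+1 j.+1 (N_mx F s) = \matrix_(a, b) (P a && (f a == b))%:R.
  apply/matrixP => a b;
    rewrite !mxE /= (insubT (fun m => m < n)%N (lt a)).
    rewrite (insubT (fun m => m < n)%N (lt b)) /= mxE.
  congr (_%:R); congr nat_of_bool.
  have -> : (Sub (i + a)%N (lt a) = w a) by apply: val_inj.
  have -> : (Sub (i + b)%N (lt b) = w b) by apply: val_inj.
  have [Pa|PNa] := boolP (P a).
    rewrite andTb -(inj_eq val_inj) /= -(fP _ Pa) eqn_add2l (inj_eq val_inj).
    case: eqP => [<-|_]; rewrite ?andbF // andbT ltn_add2l.
    by move: (Pa) => /andP[/=]; rewrite -fP // ltn_add2l.
  apply: contraNF PNa => /andP[lta /eqP sa]; rewrite /P {1}sa lta.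
  by rewrite sa /= ; have := ltn_ord b; lia.
rewrite rank_partial_perm => [|a b Pa Pb fab]; last first.
  by apply/winj/(@perm_inj _ s)/val_inj; rewrite /= -fP // -fP // fab.
rewrite -(card_imset _ winj); apply: eq_card => p; rewrite !inE.
apply/imsetP/and3P => [[a Pa ->] | [ip psp spj]].
  by move: Pa => /andP[? ?]; split; rewrite //= leq_addr.
have aP : (p - i < (j.+1 - i.+1).+1)%N by lia.
have pE : p = w (Ordinal aP) by apply: val_inj => /=; lia.
by exists (Ordinal aP); rewrite // unfold_in /P -pE psp.
Qed.

(** * The involution sigma_o and its minimality *)

(** The transpositions (a, d + a) with a < k <= d have disjoint supports, which is
    what the uniqueness of the indices in r is for: each point is moved by one factor
    at most.  An arbitrary list r makes the induction possible. *)
Lemma prod_disjoint_tperm n k d (r : seq 'I_n) (p : 'I_n) :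
    (k <= d)%N -> (d + k <= n)%N ->
    uniq r ->
  let s := (\prod_(a <- r | (a < k)%N) tperm a (insubd a (d + a)%N))%g in
  s p = (if (p < k)%N && (p \in r) then p + d
         else if (d <= p < d + k)%N && ((insubd p (p - d)%N) \in r) then p - d
         else p)%N :> nat.
Proof.
move=> kd dkn; elim: r p => [|a r IHr] p /=.
  by rewrite big_nil perm1 !in_nil !andbF.
case/andP=> aNr /IHr{}IHr; rewrite big_cons !in_cons.
have [ak|ka] := ltnP a k; last first.
  rewrite IHr; case: ltnP => /= pk.
    have -> : (p == a) = false.
      by apply/negbTE/eqP => pa; move: pk ka; rewrite pa; lia.
    by have -> : (d <= p < d + k)%N = false by lia.
  have [pd|//] := boolP (d <= p < d + k)%N.
  suff -> : (insubd p (p - d)%N == a) = false by [].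
  apply/negbTE/eqP => /(congr1 val); rewrite /= insubdK =>  [pa|].
    by move: ka; rewrite -pa; lia.
  by apply: (_ : is_true (_ < _)%N); have := ltn_ord p; lia.
have dE : insubd a (d + a)%N = (d + a)%N :> nat by rewrite insubdK //;
  apply: (_ : is_true (_ < _)%N); lia.
have subE (q : 'I_n) : insubd q (q - d)%N = (q - d)%N :> nat.
  rewrite insubdK //; apply: (_ : is_true (_ < _)%N); have := ltn_ord q; lia.
rewrite permM; case: tpermP => [->|pE|/eqP pa pNd].
- rewrite IHr dE eqxx ak /=.
  have -> : (d + a < k)%N = false by lia.
  case: ifP => //=; last by rewrite addnC.
  case/andP=> _; have -> : insubd (insubd a (d + a)%N) (d + a - d)%N = a.
    by apply: val_inj; rewrite /= -{2}dE subE dE; lia.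
  by rewrite (negPf aNr).
- have pE' : p = (d + a)%N :> nat by rewrite pE.
  have pa : insubd p (p - d)%N = a by apply: val_inj; rewrite /= subE pE'; lia.
  rewrite IHr (negPf aNr) pa eqxx pE' andbF.
  have -> : (d <= a < d + k)%N && (insubd a (a - d)%N \in r) = false by lia.
  have -> : (d + a < k)%N = false by lia. rewrite /=; case: ifP; lia.
rewrite IHr (negPf pa) /=; case: ifP => //= _.
have [pd|//] := boolP (d <= p < d + k)%N.
suff -> : (insubd p (p - d)%N == a) = false by [].
apply/negbTE/eqP => /(congr1 val); rewrite /= subE => e.
by case: pNd; apply: val_inj; rewrite /= dE; lia.
Qed.

Lemma sigma_oE n k (p : 'I_n) : (2 * k <= n)%N ->
  sigma_o n k p =
  (if p < k then p + (n - k) else if n - k <= p then p - (n - k) else p)%N :> nat.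
Proof.
move=> hk; rewrite prod_disjoint_tperm ?index_enum_uniq //; try lia.
rewrite !mem_index_enum !andbT subnK; last lia.
by rewrite ltn_ord andbT.
Qed.

Lemma invol_sigma_o n k : (2 * k <= n)%N -> invol (sigma_o n k).
Proof.
move=> hk; apply/permP => p; apply: val_inj;
  rewrite permM perm1 /= !sigma_oE //.
by have := ltn_ord p; do !case: ifP => //=; lia.
Qed.

Lemma sigma_o_arc n k (p : 'I_n) : (2 * k <= n)%N ->
  (p < sigma_o n k p)%N = (p < k)%N.
Proof. by move=> hk; rewrite sigma_oE //; do 2?[case: ifP]; lia. Qed.

Lemma card_ord_lt n k : (k <= n)%N -> #|[set p : 'I_n | (p < k)%N]| = k.
Proof.
have winj (h : (k <= n)%N) : injective (widen_ord h).
  by move=> a b /(congr1 val) /= /val_inj.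
move=> kn; rewrite -[RHS]card_ord -(card_imset _ (winj kn)).
apply: eq_card => p; rewrite inE; apply/idP/imsetP => [pk|[q _ ->] //=].
by exists (Ordinal pk) => //; apply: val_inj.
Qed.

Lemma invol_of_sigma_o n k : (2 * k <= n)%N -> invol_of k (sigma_o n k).
Proof.
move=> hk; split; first exact: invol_sigma_o.
rewrite L_arcs; last exact: invol_sigma_o.
rewrite -[RHS](@card_ord_lt n); last lia.
by apply: eq_card => p; rewrite !inE sigma_o_arc.
Qed.

(** Both sides are compared with k - (n - (j - i + 1)), where
    n - (j - i + 1) = i + (n - 1 - j) for indices counted from 0: an arc of s that is
    not inside [i, j] starts before i or ends after j, and the arcs (a, a + n - k)
    inside [i, j] have their left endpoints in an interval of that size. *)
Lemma sigma_o_le (F : fieldType) n k (s : 'S_n) : (2 * k <= n)%N ->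
  invol_of k s -> invol_le F (sigma_o n k) s.
Proof.
move=> hk [sI Ls] i j; have [ij|ji] := ltnP i j; last first.
  by rewrite !mxE ltnNge ji.
rewrite !R_arcs //; have jn := ltn_ord j.
apply: (@leq_trans (k - (i + (n.-1 - j)))).
  pose w (x : 'I_(k - (i + (n.-1 - j)))) : 'I_n := insubd i (i + x)%N.
  rewrite -[leqRHS]card_ord -cardsT; apply: leq_trans (leq_imset_card w _).
  apply/subset_leq_card/fintype.subsetP => p; rewrite inE => /and3P[ip].
  rewrite sigma_o_arc // sigma_oE // => pk; rewrite pk => pj.
  have xP : (p - i < k - (i + (n.-1 - j)))%N by lia.
  apply/imsetP; exists (Ordinal xP); rewrite ?inE //.
  apply: val_inj; rewrite /w insubdK /=; first lia.
  by apply: (_ : is_true (_ < _)%N); have := ltn_ord p; lia.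
rewrite -{1}Ls L_arcs // leq_subLR.
set A := [set p | _]; set B := [set p | _].
have AE : A \subset
    [set p : 'I_n | (p < i)%N] :|: s @: [set p : 'I_n | (j < p)%N] :|: B.
  apply/fintype.subsetP => p; rewrite !inE => ps; rewrite ps /=.
  have [//|ip] := ltnP p i; have [sj|js] := leqP (s p) j; first by rewrite orbT.
  rewrite orbF; apply/imsetP; exists (s p); rewrite ?inE //.
  by rewrite involK.
apply: leq_trans (subset_leq_card AE) _.
apply: leq_trans (leq_card_setU _ _) _; rewrite leq_add2r.
apply: leq_trans (leq_card_setU _ _) _;
  rewrite (card_ord_lt (ltnW (ltn_ord i))) leq_add2l.
apply: leq_trans (leq_imset_card _ _) _.
have -> : [set p : 'I_n | (j < p)%N] =
    [set rev_ord p | p in [set p : 'I_n | (p < n.-1 - j)%N]].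
  apply/setP => p; rewrite inE; apply/idP/imsetP => [jp|[q]].
    exists (rev_ord p); rewrite ?rev_ordK // inE /=; have := ltn_ord p; lia.
  by rewrite inE => qj ->; rewrite /=; lia.
by apply: leq_trans (leq_imset_card _ _) _; rewrite card_ord_lt //; lia.
Qed.

(** Left endpoints of arcs of length at least n - k are smaller than k, so that all
    indices below k are left endpoints.  The arc starting at k - 1 must then end at
    n - 1, the one starting at k - 2 must end at n - 2 since n - 1 is taken, and so on
    downwards. *)
Lemma sigma_o_of_long_arcs n k (s : 'S_n) : (2 * k <= n)%N -> invol_of k s ->
  (forall p : 'I_n, p < s p -> n - k <= s p - p)%N -> s = sigma_o n k.
Proof.
move=> hk [sI Ls] long; have sK := involK sI.
have arc_lt (p : 'I_n) : (p < s p)%N -> (p < k)%N.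
  by move=> /long; have := ltn_ord (s p); lia.
have arcsE (p : 'I_n) : (p < s p)%N = (p < k)%N.
  suff AE : [set p : 'I_n | (p < s p)%N] = [set p : 'I_n | (p < k)%N].
    by have := congr1 (fun A : {set _} => p \in A) AE; rewrite !inE.
  apply/eqP; rewrite eqEcard -L_arcs // Ls card_ord_lt; last lia.
  by rewrite leqnn andbT; apply/fintype.subsetP => q; rewrite !inE => /arc_lt.
have sarc (p : 'I_n) : (p < k)%N -> s p = (p + (n - k))%N :> nat.
  have [m] := ubnP (k - p); elim: m p => // m IHm p pm pk.
  have lo : (p + (n - k) <= s p)%N.
    by have := long p; rewrite arcsE => /(_ pk); lia.
  have [//|ge] := leqP (s p) (p + (n - k)); first by lia.
  (* If the arc of p were longer, its right end would be that of a later arc. *)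
  have [q qE] : exists q : 'I_n, q = (s p - (n - k))%N :> nat.
    by exists (Ordinal (leq_ltn_trans (leq_subr (n - k) (s p)) (ltn_ord (s p)))).
  have spn := ltn_ord (s p).
  have /perm_inj qp : s q = s p by apply: val_inj; rewrite /= IHm; lia.
  by move: qE; rewrite qp; lia.
apply/permP => p; apply: val_inj; rewrite /= sigma_oE //.
case: ltnP => [/sarc //|kp]; case: leqP => [dp|pd].
  have qn : (p - (n - k) < n)%N by have := ltn_ord p; lia.
  have sq : s (Ordinal qn) = p.
    by apply: val_inj; rewrite /= sarc /=; have := ltn_ord p; lia.
  by rewrite -{1}sq sK.
apply/eqP; rewrite eqn_leq [(s p <= p)%N]leqNgt arcsE -leqNgt kp andTb leqNgt.
apply/negP => lt; have := arcsE (s p); rewrite sK lt => /esym spk.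
by have := sarc _ spk; rewrite sK; lia.
Qed.

(** An interval shorter than the arcs of sigma_o contains none of them, hence no arc
    of a smaller involution. *)
Lemma sigma_o_minimal (F : fieldType) n k (s : 'S_n) : (2 * k <= n)%N ->
  invol_of k s -> invol_le F s (sigma_o n k) -> s = sigma_o n k.
Proof.
move=> hk sk le; apply: sigma_o_of_long_arcs => // p psp.
have := le p (s p); rewrite !R_arcs // leqNgt; apply: contraNleq => short.
rewrite eq_card0 => [|q]; last first.
  rewrite !inE sigma_o_arc // sigma_oE //; apply/negbTE/negP => /and3P[pq qk].
  by rewrite qk; lia.
by apply/card_gt0P; exists p; rewrite inE leqnn psp leqnn.
Qed.

(** * Degenerations in the Zariski closure *)

Lemma zariski_closureP (F : fieldType) n (A : set 'M[F]_n) (x : 'M[F]_n) :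
  zariski_closure A x <->
  forall p, (forall y, A y -> mpoly.meval (mxvec y 0) p = 0) ->
    mpoly.meval (mxvec x 0) p = 0.
Proof.
split=> [Ax p Ap | Ax M [[I ->] AI] p Ip]; last by apply: Ax => y /AI; apply.
apply: (Ax (zero_locus [set p])%classic) => //; split;
  first by exists [set p]%classic.
by move=> y Ay q ->; apply: Ap.
Qed.

(** Linear maps are continuous: composing a polynomial with f gives a polynomial. *)
Lemma zariski_closure_linear (F : fieldType) n (A : set 'M[F]_n)
    (f : {linear 'M[F]_n -> 'M[F]_n}) :
  (forall x, A x -> A (f x)) ->
  forall x, zariski_closure A x -> zariski_closure A (f x).
Proof.
move=> fA x /zariski_closureP Ax; apply/zariski_closureP => p Ap.
pose q := mpoly.comp_mpoly
  [tuple \sum_j (lin_mx f j i) *: mpoly.mpolyX F (mpoly.mnm1 j) | i < n * n] p.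
have qE y : mpoly.meval (mxvec y 0) q = mpoly.meval (mxvec (f y) 0) p.
  rewrite mpoly.comp_mpoly_meval; apply: mpoly.meval_eq => i.
  rewrite tnth_mktuple raddf_sum -mul_vec_lin mxE; apply: eq_bigr => j _.
  by rewrite /= mpoly.mevalZ mpoly.mevalXU mulrC.
by rewrite -qE; apply: Ax => y /fA/Ap; rewrite qE.
Qed.

(** A polynomial vanishing on A restricts to a univariate polynomial along the curve;
    that one has infinitely many roots, so it also vanishes at 0. *)
Lemma zariski_closure_limit (F : numFieldType) n (A : set 'M[F]_n)
    (M : 'M[{poly F}]_n) :
  (forall t, t != 0 -> zariski_closure A (map_mx (horner_eval t) M)) ->
  zariski_closure A (map_mx (horner_eval 0) M).
Proof.
move=> AM; apply/zariski_closureP => p Ap.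
pose P := \sum_(m <- mpoly.msupp p)
  (mpoly.mcoeff m p)%:P * \prod_i mxvec M 0 i ^+ mpoly.fun_of_multinom m i.
have PE t : P.[t] = mpoly.meval (mxvec (map_mx (horner_eval t) M) 0) p.
  rewrite mpoly.mevalE horner_sum; apply: eq_bigr => m _.
  rewrite hornerM hornerC horner_prod; congr (_ * _); apply: eq_bigr => i _.
  by rewrite horner_exp -map_mxvec [in RHS]mxE.
rewrite -PE; suff -> : P = 0 by rewrite horner0.
apply/eqP; apply: contraT => P0;
  pose s : seq F := [seq i.+1%:R | i <- iota 0 (size P)].
(* The integers 1, ..., size P are too many roots. *)
suff : (size s < size P)%N by rewrite size_map size_iota ltnn.
apply: max_poly_roots => //.
  apply/allP => _ /mapP[i _ ->]; rewrite /root PE; apply/eqP.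
  apply: (proj1 (zariski_closureP _ _)) Ap; apply: AM.
  by rewrite Num.Theory.pnatr_eq0.
rewrite map_inj_uniq ?iota_uniq // => i j /eqP.
by rewrite Num.Theory.eqr_nat => /eqP[].
Qed.

Definition upper (F : fieldType) n (A : 'M[F]_n) : Prop :=
  forall i j : 'I_n, (j < i)%N -> A i j = 0.

Lemma tperm_mx_delta (F : fieldType) n (i j : 'I_n) : i != j ->
  tperm_mx i j = 1%:M - delta_mx i i - delta_mx j j + delta_mx i j + delta_mx j i
    :> 'M[F]_n.
Proof.
move=> /negPf ij; have ji : (j == i) = false by rewrite eq_sym.
apply/matrixP => a b; rewrite !mxE ![_ == b]eq_sym.
case: tpermP => [->|->|/eqP/negPf-> /eqP/negPf->]; rewrite ?eqxx ?ij ?ji /=.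
- by rewrite subr0 subrr addr0 add0r.
- by rewrite subr0 subrr addr0 add0r.
by rewrite !subr0 !addr0.
Qed.

Lemma upperD (F : fieldType) n (A B : 'M[F]_n) :
  upper A -> upper B -> upper (A + B).
Proof. by move=> uA uB i j ji; rewrite mxE uA ?uB ?addr0. Qed.

Lemma upperN (F : fieldType) n (A : 'M[F]_n) : upper A -> upper (- A).
Proof. by move=> uA i j ji; rewrite mxE uA ?oppr0. Qed.

Lemma upperZ (F : fieldType) n c (A : 'M[F]_n) : upper A -> upper (c *: A).
Proof. by move=> uA i j ji; rewrite mxE uA ?mulr0. Qed.

Lemma upper_scalar (F : fieldType) n c : upper (c%:M : 'M[F]_n).
Proof. by move=> i j ji; rewrite mxE (gtn_eqF ji : (i == j) = false). Qed.

Lemma upper_delta (F : fieldType) n (i j : 'I_n) : (i <= j)%N ->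
  upper (delta_mx i j : 'M[F]_n).
Proof.
move=> ij a b ba; rewrite mxE; case: eqP => // ai; case: eqP => // bj.
by move: ba; rewrite ai bj ltnNge ij.
Qed.

(** The elementary degeneration.  In the positions i, j put
    g = [-1/t, 1; 0, t], whose inverse is h = [-t, 1; 0, 1/t].  The entries of g
    and h with a pole at t = 0 lie in the column i of g and in the row j of h, and
    these meet only the row i and the column j of M, which vanish.  So g and h may
    be replaced by S + t E_jj and S - t E_ii, where S exchanges i and j, and the
    limit at t = 0 is S M S. *)
Lemma degenerate_swap (F : numFieldType) n (A : set 'M[F]_n) (M : 'M[F]_n)
    (i j : 'I_n) :
  (forall g h x : 'M[F]_n, upper g -> upper h -> g *m h = 1%:M ->
     A x -> A (g *m x *m h)) ->
  (i < j)%N -> row i M = 0 -> col j M = 0 ->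
  zariski_closure A M ->
  zariski_closure A (tperm_mx i j *m M *m tperm_mx i j).
Proof.
move=> Aconj ij Mi Mj clM; pose S : 'M[F]_n := tperm_mx i j.
have iNj : i != j by apply: contraTneq ij => ->; rewrite ltnn.
(* N is the curve S M S + O(t), with polynomial entries in t. *)
pose cst := map_mx (@polyC F) : 'M[F]_n -> 'M[{poly F}]_n.
pose N := (cst S + 'X *: cst (delta_mx j j)) *m cst M *m
          (cst S - 'X *: cst (delta_mx i i)).
have cstK t B : map_mx (horner_eval t) (cst B) = B.
  by apply/matrixP => a b; rewrite !mxE /= /horner_eval hornerC.
have NE t : map_mx (horner_eval t) N =
    (S + t *: delta_mx j j) *m M *m (S - t *: delta_mx i i).
  rewrite !map_mxM map_mxB map_mxD !map_mxZ !cstK /=.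
  by rewrite /horner_eval hornerX.
have := NE 0; rewrite !scale0r addr0 subr0 -/S => <-.
apply: zariski_closure_limit => t t0; rewrite NE.
pose p : 'M[F]_n := delta_mx i i; pose q : 'M[F]_n := delta_mx j j.
pose e : 'M[F]_n := delta_mx i j; pose e' : 'M[F]_n := delta_mx j i.
have SE : S = 1%:M - p - q + e + e' by exact: tperm_mx_delta.
have pM : p *m M = 0 by rewrite /p -(mul_delta_mx (0 : 'I_1)) -mulmxA -rowE Mi mulmx0.
have e'M : e' *m M = 0.
  by rewrite /e' -(mul_delta_mx (0 : 'I_1)) -mulmxA -rowE Mi mulmx0.
have Mq : M *m q = 0 by rewrite /q -(mul_delta_mx (0 : 'I_1)) mulmxA -colE Mj mul0mx.
have Me' : M *m e' = 0 by rewrite /e' -(mul_delta_mx (0 : 'I_1)) mulmxA -colE Mj mul0mx.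
pose g := 1%:M - p - q + e - t^-1 *: p + t *: q.
pose h := 1%:M - p - q + e - t *: p + t^-1 *: q.
(* The two sides differ by multiples of p *m M and e' *m M. *)
have -> : (S + t *: q) *m M = g *m M.
  rewrite SE /g !(mulmxDl, mulNmx, mul_scalar_mx) -!scalemxAl pM e'M.
  by rewrite !scaler0 !oppr0 !addr0.
(* The two sides differ by multiples of M *m q and M *m e'. *)
have -> : g *m M *m (S - t *: p) = g *m M *m h.
  rewrite -!mulmxA; congr (g *m _);
    rewrite SE /h !(mulmxDr, mulmxN) -!scalemxAr Mq Me'.
  by rewrite !scaler0 !oppr0 !addr0.
have pp : p *m p = p by exact: mul_delta_mx.
have qq : q *m q = q by exact: mul_delta_mx.
have pe : p *m e = e by exact: mul_delta_mx.
have eq : e *m q = e by exact: mul_delta_mx.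
have pq : p *m q = 0 by exact: mul_delta_mx_0.
have qp : q *m p = 0 by apply: mul_delta_mx_0; rewrite eq_sym.
have ep : e *m p = 0 by apply: mul_delta_mx_0; rewrite eq_sym.
have qe : q *m e = 0 by apply: mul_delta_mx_0; rewrite eq_sym.
have ee : e *m e = 0 by apply: mul_delta_mx_0; rewrite eq_sym.
have gh : g *m h = 1%:M.
  have -> : g = 1%:M + (-1 - t^-1) *: p + (t - 1) *: q + e.
    by rewrite /g; apply/matrixP => a b; rewrite !mxE; ring.
  have -> : h = 1%:M + (-1 - t) *: p + (t^-1 - 1) *: q + e.
    by rewrite /h; apply/matrixP => a b; rewrite !mxE; ring.
  rewrite !(mulmxDl, mulmxDr, mul1mx, mulmx1) -!scalemxAl -!scalemxAr.
  rewrite pp qq pe eq pq qp ep qe ee.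
  by apply/matrixP => a b; rewrite !mxE; field.
have upp : upper p by exact: upper_delta.
have upq : upper q by exact: upper_delta.
have upe : upper e by apply: upper_delta; rewrite ltnW.
have up1 : upper (1%:M : 'M[F]_n) by exact: upper_scalar.
have upg : upper g by do !(apply: upperD || apply: upperN || apply: upperZ || done).
have uph : upper h by do !(apply: upperD || apply: upperN || apply: upperZ || done).
apply: (@zariski_closure_linear _ _ _ (mulmxr h \o mulmx g)) clM => x Ax /=.
exact: Aconj.
Qed.

(** * Sorting the endpoints of arcs *)

Definition swap_succ i x : nat :=
  if x == i then i.+1 else if x == i.+1 then i else x.

Lemma swap_succK i : involutive (swap_succ i).
Proof. by move=> x; rewrite /swap_succ; do !case: eqP => //=; lia. Qed.

Lemma tperm_swap_succ n (i j a : 'I_n) : j = i.+1 :> nat ->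
  tperm i j a = swap_succ i a :> nat.
Proof.
move=> ji; rewrite /swap_succ -ji; case: tpermP => [->|->|].
- by rewrite eqxx.
- by rewrite eqxx ji (gtn_eqF (ltnSn i)).
by move=> /eqP ai /eqP aj; rewrite !(inj_eq val_inj) (negPf ai) (negPf aj).
Qed.

(** The strictly increasing lists al and be hold the left and right endpoints of a
    matching that never nests two arcs: the m-th left endpoint goes with the m-th right
    one. *)
Definition arc_mx (F : fieldType) n (al be : seq nat) : 'M[F]_n :=
  \matrix_(p, q) ((p : nat, q : nat) \in zip al be)%:R.

Lemma arc_mx_swap (F : fieldType) n (al be : seq nat) (i j : 'I_n) :
  j = i.+1 :> nat ->
  tperm_mx i j *m arc_mx F n al be *m tperm_mx i j =
  arc_mx F n (map (swap_succ i) al) (map (swap_succ i) be).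
Proof.
move=> ji; rewrite -xcolE -xrowE; apply/matrixP => p q; rewrite !mxE.
rewrite !tperm_swap_succ //; congr (nat_of_bool _)%:R.
have inj : injective (fun x : nat * nat => (swap_succ i x.1, swap_succ i x.2)).
  move=> [a b] [c d] [/(can_inj (swap_succK i)) -> /(can_inj (swap_succK i)) ->] //.
rewrite -(mem_map inj) /= !swap_succK; congr (_ \in _).
elim: al be => [|a al IH] [|b be] //=; last by rewrite IH.
Qed.

Lemma mem_zip_fst_snd (s t : seq nat) a b :
  (a, b) \in zip s t -> (a \in s) && (b \in t).
Proof.
elim: s t => [|x s IHs] [|y t] //=; rewrite !in_cons => /orP[/eqP[-> ->]|/IHs].
  by rewrite !eqxx.
by case/andP=> -> ->; rewrite !orbT.
Qed.

(** The boolean is added to record that one strict inequality makes the comparison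
    of the sums strict; this is how the moves are seen to terminate. *)
Lemma leq_sumn_map (f g : nat -> nat) s : {in s, forall x, (f x <= g x)%N} ->
  (sumn (map f s) + has (fun x => f x < g x)%N s <= sumn (map g s))%N.
Proof.
elim: s => //= x s IHs le; have := le x (mem_head _ _).
have /IHs : {in s, forall y, (f y <= g y)%N} by move=> y ys; apply: le;
  rewrite in_cons ys orbT.
by case: ltnP => /=; case: has => /=; lia.
Qed.

(** Exchanging i and i + 1 can only break the order of s if s contains both. *)
Lemma sorted_swap_succ i s : (i \notin s) || (i.+1 \notin s) ->
  sorted ltn s -> sorted ltn (map (swap_succ i) s).
Proof.
move=> iNs; apply: (@homo_sorted_in _ _ (mem s)); last exact/allP.
(* x = i and y = i + 1 is the only pair whose order would be reversed. *)
move=> x y xs ys xy; have : ~~ ((x == i) && (y == i.+1)).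
  by apply: contraTN iNs => /andP[/eqP<- /eqP<-]; rewrite negb_or !negbK xs.
by move: xy; rewrite /swap_succ /=; do !case: eqP => //=; lia.
Qed.

Lemma initial_segment s : sorted ltn s ->
  (forall x, x.+1 \in s -> x \in s) -> s = iota 0 (size s).
Proof.
move=> s_lt down; have us : uniq s by apply: sorted_uniq s_lt;
  [exact: ltn_trans | exact: ltnn].
have le x y : (y <= x)%N -> x \in s -> y \in s.
  elim: x => [|x IHx]; first by rewrite leqn0 => /eqP->.
  by rewrite leq_eqVlt => /predU1P[-> //|yx /down]; apply: IHx.
have sub : {subset s <= iota 0 (size s)}.
  move=> x xs; rewrite mem_iota add0n /=.
  rewrite -[x.+1](size_iota 0); apply: uniq_leq_size; first exact: iota_uniq.
  by move=> y; rewrite mem_iota add0n /= ltnS => /le; apply.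
apply: (irr_sorted_eq ltn_trans ltnn) => //; first exact: iota_ltn_sorted.
apply: (uniq_min_size us sub _).2; by rewrite size_iota.
Qed.

Lemma final_segment n s : sorted ltn s -> {in s, forall x, (x < n)%N} ->
  (forall x, (x.+1 < n)%N -> x \in s -> x.+1 \in s) ->
  s = iota (n - size s) (size s).
Proof.
move=> s_lt ltn_s up; have us : uniq s by apply: sorted_uniq s_lt;
  [exact: ltn_trans | exact: ltnn].
have le x d : (x + d < n)%N -> x \in s -> (x + d)%N \in s.
  elim: d => [|d IHd]; first by rewrite addn0.
  by rewrite addnS => lt xs; apply: up => //; apply: IHd => //; apply: ltnW.
have sub : {subset s <= iota (n - size s) (size s)}.
  move=> x xs; have xn := ltn_s x xs; rewrite mem_iota.
  suff : (n - x <= size s)%N by lia.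
  rewrite -[X in (X <= _)%N](size_iota x); apply: uniq_leq_size;
    first exact: iota_uniq.
  by move=> y; rewrite mem_iota => /andP[xy yn]; rewrite -(subnKC xy);
    apply: le => //; lia.
apply: (irr_sorted_eq ltn_trans ltnn) => //; first exact: iota_ltn_sorted.
apply: (uniq_min_size us sub _).2; by rewrite size_iota.
Qed.

(** Moving left endpoints leftwards and right endpoints rightwards decreases the sum
    of all x in al and all n - y with y in be.  If no move changes the matching,
    then al is closed under predecessors and be under successors (a left endpoint
    i + 1 is not in be, a right endpoint i is not in al), which determines both. *)
Lemma arc_mx_reach (F : fieldType) n k (Q : 'M[F]_n -> Prop) :
  (forall (M : 'M[F]_n) (i j : 'I_n), (i < j)%N -> row i M = 0 -> col j M = 0 ->
     Q M -> Q (tperm_mx i j *m M *m tperm_mx i j)) ->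
  forall al be, size al = k -> size be = k -> sorted ltn al -> sorted ltn be ->
    {in al, forall x, (x < n)%N} -> {in be, forall x, (x < n)%N} ->
    {in al, forall x, x \notin be} ->
  Q (arc_mx F n al be) -> Q (arc_mx F n (iota 0 k) (iota (n - k) k)).
Proof.
move=> Qswap al be;
  have [m] := ubnP (sumn (map id al) + sumn (map (subn n) be)).
elim: m al be => // m IHm al be le_m sal sbe al_lt be_lt al_n be_n al_be QN.
(* Positions where a move applies and changes the matching. *)
pose move_at i := [&& i \notin al, i.+1 \notin be & (i.+1 \in al) || (i \in be)].
have [/hasP[ i ]|/hasPn noi] := boolP (has move_at (iota 0 n.-1)); last first.
  have lt_n x : (x.+1 < n)%N -> x \in iota 0 n.-1 by rewrite mem_iota; lia.
  have <- : al = iota 0 k.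
    rewrite -sal; apply: initial_segment => // x xs; apply: contraT => x1.
    have := noi _ (lt_n _ (al_n _ xs)).
    by rewrite /move_at x1 xs (al_be _ xs).
  have <- // : be = iota (n - k) k.
  rewrite -sbe; apply: final_segment => // x xn xs; apply: contraT => x1.
  have := noi _ (lt_n _ xn);
    rewrite /move_at x1 xs orbT /= andbT negbK => /al_be.
  by rewrite xs.
rewrite mem_iota /move_at => i_n /and3P[i_al i_be alt].
have ltin : (i < n)%N by lia.
have ltin1 : (i.+1 < n)%N by lia.
pose i' := Ordinal ltin; pose j' := Ordinal ltin1.
have sw_lt x : (x < n)%N -> (swap_succ i x < n)%N.
  by rewrite /swap_succ; do !case: eqP => //=; lia.
apply: (IHm (map (swap_succ i) al) (map (swap_succ i) be));
  rewrite ?size_map //.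
- have al_le : {in al, forall x, (swap_succ i x <= id x)%N}.
    move=> x xs; rewrite /swap_succ; case: eqP => [xi|_];
      first by rewrite xi (negPf i_al) in xs.
    by case: eqP => //; lia.
  have be_le : {in be, forall x, ((subn n \o swap_succ i) x <= n - x)%N}.
    move=> x xs; rewrite /swap_succ /=; case: eqP => [->|_]; first lia.
    by case: eqP => [xi|//]; rewrite xi (negPf i_be) in xs.
  have := leq_sumn_map al_le; have := leq_sumn_map be_le.
  rewrite map_comp map_id !map_id.
  (* At least one endpoint really moves, which makes the measure drop. *)
  set c1 := has _ _; set c2 := has _ _.
  have : c1 || c2.
    case/orP: alt => [j_al | i_be'].
      apply/orP; right; apply/hasP; exists i.+1 => //.
      by rewrite /swap_succ eqxx (gtn_eqF (ltnSn i)).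
    by apply/orP; left; apply/hasP; exists i => //=; rewrite /swap_succ eqxx;
      lia.
  by rewrite map_id in le_m; case: c1; case: c2 => //=; lia.
- by apply: sorted_swap_succ; rewrite // i_al.
- by apply: sorted_swap_succ; rewrite // i_be orbT.
- by move=> _ /mapP[x /al_n xs ->]; apply: sw_lt.
- by move=> _ /mapP[x /be_n xs ->]; apply: sw_lt.
- by move=> _ /mapP[x /al_be xs ->]; rewrite mem_map //;
    apply: can_inj (swap_succK i).
rewrite -(@arc_mx_swap _ _ _ _ i' j') //; apply: Qswap => //=.
  apply/rowP => q; rewrite !mxE.
  by case: (boolP (_ \in _)) => // /mem_zip_fst_snd/andP[];
    rewrite /= (negPf i_al).
apply/colP => q; rewrite !mxE.
by case: (boolP (_ \in _)) => // /mem_zip_fst_snd/andP[_];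
  rewrite /= (negPf i_be).
Qed.

(** * Jordan form of two-column tableaux *)

Lemma jordan_type_conj (F : fieldType) n (g h x : 'M[F]_n) la :
  g *m h = 1%:M -> jordan_type x la -> jordan_type (g *m x *m h) la.
Proof.
move=> gh [pla [P Pu PxP]]; split=> //; have [gu hu] := mulmx1_unit gh.
have hg : h *m g = 1%:M by apply: mulmx1C.
exists (P *m h); first by rewrite unitmx_mul Pu hu.
have PhK : (P *m h) *m (g *m invmx P) = 1%:M.
  by rewrite mulmxA -(mulmxA P) hg mulmx1 mulmxV.
have -> : invmx (P *m h) = g *m invmx P.
  by rewrite -[LHS]mulmx1 -PhK (mulmxA (invmx _)) mulVmx ?mul1mx // unitmx_mul Pu.
rewrite -PxP !mulmxA -(mulmxA P) hg mulmx1 -(mulmxA _ h) hg mulmx1 //.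
Qed.

Lemma jordan_type_perm (F : fieldType) n (s : 'S_n) (x : 'M[F]_n) la :
  is_partition n la -> (forall p q, x (s p) (s q) = jordan_mx F n la p q) ->
  jordan_type x la.
Proof.
move=> pla xE.
have -> : x = perm_mx s^-1 *m jordan_mx F n la *m perm_mx s.
  rewrite -row_permE -[in perm_mx s](invgK s) -col_permE.
  by apply/matrixP => p q; rewrite [RHS]mxE [RHS]mxE -xE !permKV.
apply: jordan_type_conj; first by rewrite -perm_mxM mulVg perm_mx1.
split=> //; exists 1%:M; first exact: unitmx1.
by rewrite mul1mx invmx1 mulmx1.
Qed.

(** The rows with two entries are the arcs; entries are counted from 1,
    indices from 0. *)
Definition row_pair_mx (F : fieldType) n (T : seq (seq nat)) : 'M[F]_n :=
  \matrix_(p, q) ([:: p.+1; q.+1] \in T)%:R.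

(** Listing the entries of T row by row turns a row [x; y] into two consecutive
    indices of a common block of size 2, and a row [x] into a block of size 1.  The
    permutation given by this reading order conjugates the matrix to its Jordan form. *)
Lemma jordan_type_rows (F : fieldType) n (T : seq (seq nat)) :
  sorted geq (shape T) -> all (fun r => 0 < size r <= 2)%N T ->
  perm_eq (flatten T) (iota 1 n) ->
  jordan_type (row_pair_mx F n T) (shape T).
Proof.
move=> sT T2 pT;
  have szT : size (flatten T) = n by rewrite (perm_size pT) size_iota.
have uT : uniq (flatten T) by rewrite (perm_uniq pT) iota_uniq.
have ltT (p : 'I_n) : ((nth 0 (flatten T) p).-1 < n)%N.
  have : nth 0%N (flatten T) p \in iota 1 n by rewrite -(perm_mem pT) mem_nth ?szT.
  by rewrite mem_iota; lia.
have gt0 (p : 'I_n) : (0 < nth 0 (flatten T) p)%N.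
  have : nth 0%N (flatten T) p \in iota 1 n by rewrite -(perm_mem pT) mem_nth ?szT.
  by rewrite mem_iota; lia.
pose w p := Ordinal (ltT p).
have wE p : (w p).+1 = nth 0%N (flatten T) p by rewrite /= prednK.
have winj : injective w.
  move=> p q /(congr1 (fun a : 'I_n => a.+1)); rewrite !wE => /eqP.
  by rewrite nth_uniq ?szT // => /eqP/val_inj.
apply: (@jordan_type_perm _ _ (perm winj)).
  split=> //; last by rewrite -size_flatten.
  by apply/negP => /mapP[r rT r0]; have := allP T2 _ rT; rewrite -r0.
move=> p q; rewrite !permE !mxE !wE; congr (nat_of_bool _)%:R.
have sumT : sumn (shape T) = n by rewrite -size_flatten.
apply/idP/andP => [| [/eqP pq /eqP rpq]].
  case/(nthP [::]) => r rT rE.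
  have c_lt c : (c < 2)%N -> (c < nth 0 (shape T) r)%N.
    by rewrite (nth_map [::]) // rE.
  have fE c : (c < 2)%N -> nth 0%N (flatten T) (flatten_index (shape T) r c) =
      nth 0%N (nth [::] T r) c.
    by move=> c2; rewrite nth_flatten flatten_indexKl ?flatten_indexKr ?c_lt.
  have f_lt c : (c < 2)%N -> (flatten_index (shape T) r c < n)%N.
    by move=> c2; rewrite -sumT; apply/flatten_indexP/c_lt.
  have pE : flatten_index (shape T) r 0 = p.
    by apply/eqP; rewrite -(nth_uniq 0%N _ _ uT) ?szT ?f_lt // fE // rE.
  have qE : flatten_index (shape T) r 1 = q.
    by apply/eqP; rewrite -(nth_uniq 0%N _ _ uT) ?szT ?f_lt // fE // rE.
  rewrite -pE -qE !flatten_indexKl ?c_lt //; split=> //.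
  by rewrite /flatten_index addn0 addn1.
rewrite !nth_flatten -rpq; set r := reshape_index _ p.
have r_lt : (r < size T)%N by rewrite -(size_map size); apply: reshape_indexP;
  rewrite sumT.
have oq : reshape_offset (shape T) q = (reshape_offset (shape T) p).+1.
  have := reshape_indexK (shape T) p; have := reshape_indexK (shape T) q.
  by rewrite /flatten_index -rpq pq; lia.
have : (reshape_offset (shape T) q < nth 0 (shape T) r)%N.
  by rewrite /r rpq; apply: reshape_offsetP; rewrite sumT.
rewrite (nth_map [::]) // oq; have := allP T2 _ (mem_nth [::] r_lt).
have := mem_nth [::] r_lt; case: (nth [::] T r) => [|a [|b []]] //=.
by case: reshape_offset.
Qed.

(** * Triangular conjugation and the strata *)

Lemma pi_mx_widen (F : fieldType) n i (le_in : ((i - 1).+1 <= n)%N) (A : 'M[F]_n) :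
  pi_mx 1 i A = mxsub (widen_ord le_in) (widen_ord le_in) A.
Proof.
have lt (a : 'I_(i - 1).+1) : (a < n)%N by apply: leq_trans (ltn_ord a) le_in.
apply/matrixP => a b; rewrite !mxE /=.
rewrite (insubT (fun m => m < n)%N (lt a)) (insubT (fun m => m < n)%N (lt b)) /=.
by congr (A _ _); apply: val_inj.
Qed.

(** A corner block is multiplicative on triangular matrices: an index beyond i
    contributes nothing to the first i columns of B. *)
Lemma pi_mxM (F : fieldType) n i (A B : 'M[F]_n) : (1 <= i <= n)%N -> upper B ->
  pi_mx 1 i (A *m B) = pi_mx 1 i A *m pi_mx 1 i B.
Proof.
move=> /andP[i1 i_n] uB; have le_in : ((i - 1).+1 <= n)%N by lia.
rewrite !(pi_mx_widen le_in); apply/matrixP => a b; rewrite !mxE.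
rewrite (bigID (fun c : 'I_n => c < (i - 1).+1)%N) /= addrC big1 => [|c];
  last first.
  by rewrite -leqNgt => ic; rewrite uB ?mulr0 // (leq_trans (ltn_ord b)).
by rewrite add0r big_ord_narrow; apply: eq_bigr => c _; rewrite !mxE.
Qed.

Lemma pi_mx1 (F : fieldType) n i : (1 <= i <= n)%N ->
  pi_mx 1 i (1%:M : 'M[F]_n) = 1%:M.
Proof.
move=> /andP[i1 i_n]; have le_in : ((i - 1).+1 <= n)%N by lia.
by rewrite !(pi_mx_widen le_in); apply/matrixP => a b; rewrite !mxE.
Qed.

Lemma strict_upper_upper (F : fieldType) n (A : 'M[F]_n) : strict_upper A -> upper A.
Proof. by move=> sA i j /ltnW; apply: sA. Qed.

Lemma strict_upper_conj (F : fieldType) n (g h x : 'M[F]_n) :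
  upper g -> upper h -> strict_upper x -> strict_upper (g *m x *m h).
Proof.
move=> ug uh sx i j ji; rewrite mxE big1 // => b _.
have [jb|bj] := ltnP j b; first by rewrite (uh b j) ?mulr0.
rewrite mxE big1 ?mul0r // => a _.
have [ai|ia] := ltnP a i; first by rewrite (ug i a) ?mul0r.
by rewrite sx ?mulr0 // (leq_trans bj) // (leq_trans ji).
Qed.

(** The set whose closure in the orbit is the orbital variety of T. *)
Definition stratum (F : fieldType) n (T : seq (seq nat)) (u : 'M[F]_n) : Prop :=
  nilp_orbit (shape T) u /\ strict_upper u /\
  forall i : nat, (1 <= i <= n)%N -> jordan_type (pi_mx 1 i u) (sub_shape T i).

Lemma stratum_conj (F : fieldType) n T (g h x : 'M[F]_n) :
  upper g -> upper h -> g *m h = 1%:M ->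
  stratum T x -> stratum T (g *m x *m h).
Proof.
move=> ug uh gh [xT [sx xi]]; split; first exact: jordan_type_conj.
split=> [|i i_n]; first exact: strict_upper_conj.
rewrite !pi_mxM //; last exact: strict_upper_upper.
by apply: jordan_type_conj (xi i i_n); rewrite -pi_mxM // gh pi_mx1.
Qed.

Definition sub_tab (T : seq (seq nat)) i :=
  [seq r <- [seq [seq x <- row | (x <= i)%N] | row <- T] | (0 < size r)%N].

Lemma shape_sub_tab T i : shape (sub_tab T i) = sub_shape T i.
Proof. by rewrite /sub_shape /shape filter_map. Qed.

Lemma perm_sub_tab n T i : perm_eq (flatten T) (iota 1 n) -> (i <= n)%N ->
  perm_eq (flatten (sub_tab T i)) (iota 1 i).
Proof.
move=> pT i_n;
  have -> : flatten (sub_tab T i) = [seq x <- flatten T | (x <= i)%N].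
  rewrite /sub_tab; elim: (T) => //= r S IHS; rewrite filter_cat -IHS.
  by case: ifP => //; rewrite lt0n => /negbFE/nilP ->.
apply: perm_trans (perm_filter _ pT) _.
rewrite -(subnKC i_n) iotaD filter_cat.
rewrite (eq_in_filter (a2 := predT)) => [|x]; last by rewrite mem_iota /=; lia.
rewrite (eq_in_filter (a2 := pred0) (s := iota _ (n - i))) => [|x]; last first.
  by rewrite mem_iota /=; lia.
by rewrite filter_predT filter_pred0 cats0.
Qed.

Lemma sub_tab_pair T i x y : all (fun r => 0 < size r <= 2)%N T ->
  ([:: x; y] \in sub_tab T i) = ([:: x; y] \in T) && (x <= i)%N && (y <= i)%N.
Proof.
move=> /allP T2; rewrite mem_filter /=;
  apply/mapP/andP => [[r rT rE] | [/andP[xyT xi] yi]].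
  have := T2 r rT; have := size_filter (fun z => z <= i)%N r; rewrite -rE /=.
  have := count_size (fun z => z <= i)%N r => le2 c2 /andP[_ s2].
  have /all_filterP rr : all (fun z => z <= i)%N r by rewrite all_count -c2;
    lia.
  by move: rT; rewrite -rr -rE => ->; have := filter_all (fun z => z <= i)%N r;
    rewrite -rE /= => /and3P[-> ->].
by exists [:: x; y] => //=; rewrite xi yi.
Qed.

Lemma all_sub_tab T i : all (fun r => 0 < size r <= 2)%N T ->
  all (fun r => 0 < size r <= 2)%N (sub_tab T i).
Proof.
move=> /allP T2; apply/allP => r;
  rewrite mem_filter => /andP[-> /mapP[r' r'T ->]] /=.
by rewrite size_filter; apply: leq_trans (count_size _ _) _;
  case/andP: (T2 _ r'T).
Qed.

(** The columns of T increase, so that a row never keeps fewer entries at most i than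
    the next one. *)
Lemma sub_shape_sorted n T i : std_tableau n T -> all (fun r => 0 < size r <= 2)%N T ->
  sorted geq (sub_shape T i).
Proof.
case=> -[sT _ _] _ _ colT T2.
apply: sorted_filter; first by move=> a b c /= ba ac; apply: leq_trans ac ba.
apply/(sortedP 0%N) => j; rewrite !size_map => jT.
have jT' := ltnW jT; rewrite !(nth_map [::]) ?size_map //.
rewrite /= !size_filter; have c0 := colT j 0%N; have c1 := colT j 1%N.
have := sortedP 0%N sT j; rewrite size_map => /(_ jT).
rewrite !(nth_map [::]) //= => le.
have := allP T2 _ (mem_nth [::] jT); have := allP T2 _ (mem_nth [::] (ltnW jT)).
move: le c0 c1; case: (nth [::] T j.+1) => [|x [|y []]] //=;
  case: (nth [::] T j) => [|x' [|y' []]] //=; lia.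
Qed.

(** The i-th corner block of the matrix of T is the matrix of the subtableau with
    entries at most i, so that every condition on a corner block is an instance of the
    Jordan form of such a matrix. *)
Lemma row_pair_mx_stratum (F : fieldType) n T : std_tableau n T ->
  all (fun r => 0 < size r <= 2)%N T -> stratum T (row_pair_mx F n T).
Proof.
move=> stdT T2; have [[sT zT sumT] pT rT colT] := stdT.
split; first exact: jordan_type_rows.
split=> [p q qp | i /andP[i1 i_n]].
  rewrite mxE; case: (boolP (_ \in T)) => // /(allP rT) /=; rewrite andbT; lia.
have le_in : ((i - 1).+1 <= n)%N by lia.
rewrite (pi_mx_widen le_in) -shape_sub_tab.
have -> : mxsub (widen_ord le_in) (widen_ord le_in) (row_pair_mx F n T) =
          row_pair_mx F (i - 1).+1 (sub_tab T i).
  apply/matrixP => p q; rewrite !mxE sub_tab_pair //=.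
  have -> : (p < i)%N by have := ltn_ord p; lia.
  have -> : (q < i)%N by have := ltn_ord q; lia.
  by rewrite !andbT.
apply: jordan_type_rows.
- by rewrite shape_sub_tab; apply: sub_shape_sorted stdT T2.
- exact: all_sub_tab.
by rewrite subn1 prednK //; apply: perm_sub_tab pT i_n.
Qed.

(** * A common point of the orbital varieties *)

Lemma size_row_Tab2 n k T : Tab2 n k T ->
  size T = (n - k)%N /\
  forall j, (j < n - k)%N -> size (nth [::] T j) = (1 + (j < k))%N.
Proof.
case=> _ shT; have szT : size T = (n - k)%N.
  by rewrite -(size_map size) -/(shape T) shT /conj_part size_map size_iota.
split=> // j jn; rewrite -(nth_map [::] 0%N size) ?szT // -/(shape T) shT.
by rewrite (nth_map 0%N) ?size_iota // nth_iota //= add0n jn addn0.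
Qed.

Lemma all_Tab2 n k T : Tab2 n k T -> all (fun r => 0 < size r <= 2)%N T.
Proof.
case/size_row_Tab2 => szT szr; apply/(all_nthP [::]) => j;
  rewrite szT => /szr ->.
by case: (j < k)%N.
Qed.

Definition column (c k : nat) (T : seq (seq nat)) : seq nat :=
  [seq (nth 0%N r c).-1 | r <- take k T].

(** Only the first k rows of T have two entries. *)
Lemma row_pair_mx_arc (F : fieldType) n k T : (2 * k <= n)%N -> Tab2 n k T ->
  row_pair_mx F n T = arc_mx F n (column 0 k T) (column 1 k T).
Proof.
move=> hk TT; have [szT szr] := size_row_Tab2 TT.
have [[_ pT _ _] _] := TT.
apply/matrixP => p q; rewrite !mxE zip_map; congr (nat_of_bool _)%:R.
have pos r x : r \in T -> x \in r -> (0 < x)%N.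
  move=> rT xr; have : x \in flatten T by apply/flattenP; exists r.
  by rewrite (perm_mem pT) mem_iota => /andP[].
have k_le : (k <= n - k)%N by lia.
apply/idP/mapP => [pqT | [r rT [-> ->]]].
  exists [:: p.+1; q.+1] => //; have := pqT => /(nthP [::])[j jT jE].
  have jk : (j < k)%N.
    by have := szr j; rewrite -szT => /(_ jT); rewrite jE; case: (j < k)%N.
  by rewrite -jE -(nth_take [::] jk) mem_nth // size_takel // szT.
have {rT} : exists2 j, (j < k)%N & nth [::] T j = r.
  case/(nthP [::]): rT => j; rewrite size_takel ?szT // => jk <-.
  by exists j; rewrite // nth_take.
case=> j jk jE; have jn : (j < n - k)%N by lia.
have rT : r \in T by rewrite -jE mem_nth ?szT.
have := szr j jn; have := pos r; rewrite jE jk.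
case: (r) rT => [|x [|y []]] //= rT /(_ _ rT) gt0 _.
by rewrite !prednK ?gt0 ?mem_head // in_cons mem_head orbT.
Qed.

Lemma uniq_flatten_nth (T : seq (seq nat)) j c j' c' : uniq (flatten T) ->
  (c < size (nth [::] T j))%N -> (c' < size (nth [::] T j'))%N ->
  nth 0%N (nth [::] T j) c = nth 0%N (nth [::] T j') c' -> c = c'.
Proof.
move=> uT.
have shE i : nth 0%N (shape T) i = size (nth [::] T i).
  have [lt|ge] := ltnP i (size T); first by rewrite (nth_map [::]).
  by rewrite !nth_default ?size_map.
rewrite -!shE => cj cj' eq.
have fE i d : (d < nth 0 (shape T) i)%N ->
    nth 0%N (flatten T) (flatten_index (shape T) i d) = nth 0%N (nth [::] T i) d.
  by move=> di; rewrite nth_flatten flatten_indexKl ?flatten_indexKr.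
have : flatten_index (shape T) j c = flatten_index (shape T) j' c'.
  apply/eqP; rewrite -(nth_uniq 0%N _ _ uT) ?size_flatten ?flatten_indexP //.
  by rewrite !fE // eq.
by move/(congr1 (reshape_offset (shape T))); rewrite !flatten_indexKr.
Qed.

(** The facts about a column of T that make it a list of endpoints of arcs. *)
Lemma columnP c k n T : (2 * k <= n)%N -> Tab2 n k T -> (c < 2)%N ->
  [/\ size (column c k T) = k, sorted ltn (column c k T),
      {in column c k T, forall x, (x < n)%N} &
      forall x, x \in column c k T -> exists j,
        (c < size (nth [::] T j))%N /\ nth 0%N (nth [::] T j) c = x.+1].
Proof.
move=> hk TT c2; have [szT szr] := size_row_Tab2 TT.
have [[_ pT _ colT] _] := TT.
have szc : size (column c k T) = k by rewrite size_map size_takel ?szT //; lia.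
have c_lt j : (j < k)%N -> (c < size (nth [::] T j))%N.
  by move=> jk; rewrite szr ?jk //; lia.
have in_n j : (j < k)%N -> (0 < nth 0 (nth [::] T j) c <= n)%N.
  move=> jk; have jn : (j < size T)%N by lia.
  have : nth 0%N (nth [::] T j) c \in flatten T.
    by apply/flattenP; exists (nth [::] T j); rewrite mem_nth // c_lt.
  by rewrite (perm_mem pT) mem_iota; lia.
have nthE j : (j < k)%N -> nth 0%N (column c k T) j = (nth 0%N (nth [::] T j) c).-1.
  by move=> jk; rewrite (nth_map [::]) ?nth_take // size_takel ?szT //; lia.
split=> //.
- apply/(sortedP 0%N) => j; rewrite szc => jk; rewrite !nthE //;
    last exact: ltnW.
  have := colT j c (c_lt _ jk); have := in_n _ jk; have := in_n j (ltnW jk).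
  by rewrite /=; lia.
- move=> x /(nthP 0%N)[j]; rewrite szc => jk <-; rewrite nthE //.
  by have := in_n j jk; lia.
move=> x /(nthP 0%N)[j]; rewrite szc => jk <-; exists j;
  rewrite c_lt // nthE //.
by rewrite prednK //; case/andP: (in_n j jk).
Qed.

(** The two properties of a point of the orbital variety, lying in the closure and in
    the orbit, both survive the moves, so that they pass from the matrix of T to that
    of sigma_o(k). *)
Lemma arc_mx_in_orbital_variety (F : numFieldType) n k T : (2 * k <= n)%N ->
  Tab2 n k T -> orbital_variety F n T (arc_mx F n (iota 0 k) (iota (n - k) k)).
Proof.
move=> hk TT; have [[sz0 s0 n0 in0] [sz1 s1 n1 in1]] :=
  (columnP hk TT (isT : 0 < 2)%N, columnP hk TT (isT : 1 < 2)%N).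
have [stdT _] := TT.
have strN : stratum T (arc_mx F n (column 0 k T) (column 1 k T)).
  by rewrite -row_pair_mx_arc //; apply: row_pair_mx_stratum (all_Tab2 TT).
suff : (zariski_closure (stratum T) `&` nilp_orbit (shape T))%classic
    (arc_mx F n (iota 0 k) (iota (n - k) k)) by [].
apply: (@arc_mx_reach F n k
  (zariski_closure (@stratum F n T) `&` nilp_orbit (shape T))%classic) => //.
- move=> M i j ij Mi Mj [clM JM]; split.
    by apply: degenerate_swap => // g h x ug uh gh; apply: stratum_conj.
  by apply: jordan_type_conj JM; rewrite -perm_mxM tperm2 perm_mx1.
- exact: sz0.
- exact: sz1.
- exact: s0.
- exact: s1.
- exact: n0.
- exact: n1.
- move=> x /in0[j [j0 jx]]; apply/negP => /in1[j' [j1 jx']].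
  have [_ pT _ _] := stdT.
  have uT : uniq (flatten T) by rewrite (perm_uniq pT) iota_uniq.
  by have := uniq_flatten_nth uT j0 j1; rewrite jx jx' => /(_ erefl).
by split; [apply: sub_gen_smallest | case: strN].
Qed.

Theorem proposition3p14 (R : realType) (n k : nat)
    (hn : (1 <= n)%N) (hk : (2 * k <= n)%N) :
  [/\ minimal_invol R[i] k (sigma_o n k),
      forall s : 'S_n, minimal_invol R[i] k s -> s = sigma_o n k,
      forall s : 'S_n, invol_of k s -> invol_le R[i] (sigma_o n k) s &
      forall S T : seq (seq nat), Tab2 n k S -> Tab2 n k T ->
        (orbital_variety R[i] n T `&` orbital_variety R[i] n S !=set0)%classic].
Proof.
have invo := invol_of_sigma_o hk.
split=> [|s [sk smin]|s sk|S T SS TT].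
- by split=> // s sk; apply: sigma_o_minimal.
- by apply/esym/smin => //; apply: sigma_o_le.
- exact: sigma_o_le.
exists (arc_mx R[i] n (iota 0 k) (iota (n - k) k)).
by split; apply: arc_mx_in_orbital_variety.
Qed.
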